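(* Let $h\in\mathbb R[x_1,\ldots,x_n]$ be homogeneous and hyperbolic in direction $e\in\mathbb R^n$, and let $e'\in\mathring{\Lambda}_e(h)$. Then $\mathcal A_{e'}(h)\cong\mathcal A_e(h)$ as unital $*$-algebras.
   Context: A homogeneous polynomial $h\in\mathbb R[x]$ is hyperbolic in direction $e\in\mathbb R^n$ if $h(e)\neq0$ and for every $a\in\mathbb R^n$ the polynomial $h_{a,e}(t):=h(a-te)$ has only real roots; $\mathring\Lambda_e(h)=\{a\in\mathbb R^n: h_{a,e}(t)\text{ has only positive roots}\}$ (it is known that $h$ is then also hyperbolic in every direction $e'\in\mathring\Lambda_e(h)$). For $a\in\mathbb R^n$ write $a\bullet z=a_1z_1+\cdots+a_nz_n$. Let $\mathbb C\langle z_1,\ldots,z_n\rangle$ be the free noncommutative unital algebra with involution determined by $z_i^*=z_i$. For a direction $u$ in which $h$ is hyperbolic, let $J_u(h)$ be the two-sided ideal generated by all $h_{a,u}(a\bullet z)$, $a\in\mathbb R^n$, where $h_{a,u}(t)=h(a-tu)$, together with $1-u\bullet z$, and let $\mathcal A_u(h)=\mathbb C\langle z\rangle/J_u(h)$, a unital $*$-algebra. *)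

(* Defs.v *)
From HB Require Import structures.
From mathcomp Require Import all_boot all_order all_algebra.
From mathcomp Require Import reals.
From mathcomp Require Import complex.
From mathcomp Require Import monalg.
From mathcomp Require Import mpoly.

Set Implicit Arguments.
Unset Strict Implicit.
Unset Printing Implicit Defensive.

Import Order.TTheory GRing.Theory Num.Theory.
Local Open Scope ring_scope.

Section HyperbolicAlgebra.
Variables (R : realType) (n : nat).

Local Notation C := (R[i]).

Definition hdir (h : mpoly.mpoly n R) (a u : 'I_n -> R) : {poly R} :=
  mmap (@polyC R) (fun i => (a i)%:P - u i *: 'X) h.

Definition cpoly (p : {poly R}) : {poly C} :=
  map_poly (fun x : R => (x%:C)%C) p.

Definition hyperbolic (h : mpoly.mpoly n R) (e : 'I_n -> R) : Prop :=
  h.@[e] != 0 /\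
  forall (a : 'I_n -> R) (t : C), root (cpoly (hdir h a e)) t -> Im t = 0.

Definition hcone_int (h : mpoly.mpoly n R) (e : 'I_n -> R) (a : 'I_n -> R) : Prop :=
  forall t : C, root (cpoly (hdir h a e)) t -> Im t = 0 /\ 0 < Re t.

Definition FA := monalg.malg (monalg.fmonom 'I_n) C.

Definition zvar (i : 'I_n) : FA := monalg.mkmalgU (monalg.fmu i) 1.

(* the involution determined by z_i^* = z_i: conjugate the coefficients
   and reverse the words. *)
Definition fstar (p : FA) : FA :=
  \sum_(k <- finmap.enum_fset (monalg.msupp p))
     monalg.mkmalgU (monalg.FMonom (rev (monalg.fmonom_val k)))
                    (conjc (monalg.mcoeff k p)).

Definition lin (a : 'I_n -> R) : FA := \sum_(i < n) ((a i)%:C)%C *: zvar i.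

Definition hz (h : mpoly.mpoly n R) (a u : 'I_n -> R) : FA :=
  let p := hdir h a u in \sum_(k < size p) ((p`_k)%:C)%C *: (lin a) ^+ k.

Definition ideal_gen (S : FA -> Prop) (p : FA) : Prop :=
  exists (k : nat) (l s r : 'I_k -> FA),
    (forall j, S (s j)) /\ p = \sum_(j < k) l j * s j * r j.

Definition Jgen (h : mpoly.mpoly n R) (u : 'I_n -> R) (x : FA) : Prop :=
  (exists a : 'I_n -> R, x = hz h a u) \/ x = 1 - lin u.

(* J_u(h); A_u(h) is C<z>/J_u(h), represented by FA modulo J_u(h) *)
Definition J (h : mpoly.mpoly n R) (u : 'I_n -> R) : FA -> Prop :=
  ideal_gen (Jgen h u).

(* The quotient unital *-algebras FA/I and FA/K are isomorphic:
   there is a map f on representatives which induces a well-defined map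
   FA/I -> FA/K that is a unital *-algebra homomorphism and a bijection. *)
Definition quot_star_iso (I K : FA -> Prop) : Prop :=
  exists f : FA -> FA,
    [/\ (* well defined *) forall p q, I (p - q) -> K (f p - f q),
        (* additive *) forall p q, K (f (p + q) - (f p + f q)),
        (* C-linear *) forall (c : C) p, K (f (c *: p) - c *: f p),
        (* multiplicative *) forall p q, K (f (p * q) - f p * f q)
      & (* unital *) K (f 1 - 1)] /\
    [/\ (* *-preserving *) forall p, K (f (fstar p) - fstar (f p)),
        (* injective *) forall p q, K (f p - f q) -> I (p - q)
      & (* surjective *) forall q, exists p, K (f p - q)].

End HyperbolicAlgebra.

(* Main.v *)
Require Import Defs.
From HB Require Import structures.
From mathcomp Require Import all_boot all_order all_algebra.
From mathcomp Require Import reals.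
From mathcomp Require Import complex.
From mathcomp Require Import -(notations) monalg.
From mathcomp Require Import mpoly.
From mathcomp Require Import ring.

(** Put [E = e' . z] in [A_e(h)]. It is annihilated by [h_{e',e}], whose roots are
positive, so [E] has a real polynomial [W] with [W^2 E = 1]; the isomorphism is
[z_i |-> W z_i W]. It is well defined because [W A W] is conjugate to
[W^2 A = E^-1 A] for [A = a . z], and [h_{a,e'}(E^-1 A) = 0]: the polynomial
[h(a + y e' - t e)] vanishes at [t = A + y E] for all real [y], so with [y], [t]
central it has the right factor [t - (A + y E)], which at [t = 0] is
[- E (y + E^-1 A)]. The inverse map is [z_i |-> W' z_i W'], where [W'] is the
polynomial inverse of [W] evaluated at [(e . z)^-1] in place of [E]. *)

Set Implicit Arguments.
Unset Strict Implicit.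
Unset Printing Implicit Defensive.

Import Order.TTheory GRing.Theory Num.Theory.
Local Open Scope ring_scope.

(** * Inverse square roots of the variable modulo a polynomial with positive roots *)

Lemma sqrt_inverse_lift (R : rcfType) (q w : {poly R}) (r : R) :
  0 < r -> q %| w ^+ 2 * 'X - 1 ->
  exists w' : {poly R}, q * ('X - r%:P) %| w' ^+ 2 * 'X - 1.
Proof.
move=> r0 /dvdpP[m Hm].
(* Adding [c * q] to [w] keeps divisibility by [q]; the constant [c] stays free, to make the new
   cofactor vanish at [r]. *)
have lift c : (w + c%:P * q) ^+ 2 * 'X - 1 =
    q * (m + (c + c)%:P * (w * 'X) + c%:P ^+ 2 * (q * 'X)).
  have -> : (w + c%:P * q) ^+ 2 * 'X - 1 =
     (w ^+ 2 * 'X - 1) + (c + c)%:P * (q * w * 'X) + c%:P ^+ 2 * (q * q * 'X).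
    by rewrite polyCD; ring.
  by rewrite Hm; ring.
suff [c Hc] : exists c : R,
    (m + (c + c)%:P * (w * 'X) + c%:P ^+ 2 * (q * 'X)).[r] = 0.
  exists (w + c%:P * q); rewrite lift dvdp_mul //.
  by rewrite dvdp_XsubCl; apply/rootP.
have Hr : w.[r] ^+ 2 * r - 1 = m.[r] * q.[r].
  by have := congr1 (horner^~ r) Hm; rewrite !hornerE.
(* If [r] is already a root of [q], the cofactor at [r] is affine in [c] with slope [2 * w.[r] * r],
   as in Hensel lifting. *)
have [q0 | q0] := eqVneq q.[r] 0.
  have wr : w.[r] != 0.
    apply: contra_eq_neq Hr => ->.
    by rewrite q0 expr0n /= mul0r mulr0 sub0r oppr_eq0 oner_eq0.
  exists (- m.[r] / (2 * w.[r] * r)).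
  rewrite !(hornerD, hornerM, hornerC, hornerX, horner_exp) q0.
  by field; rewrite wr gt_eqF.
(* If [r] is a new root, this [c] gives the corrected polynomial the value [1 / sqrt r] at [r]. *)
exists (((Num.sqrt r)^-1 - w.[r]) / q.[r]).
rewrite !(hornerD, hornerM, hornerC, hornerX, horner_exp); set s := Num.sqrt r.
have s0 : s != 0 by rewrite gt_eqF // sqrtr_gt0.
have rs : r = s ^+ 2 by rewrite sqr_sqrtr // ltW.
apply: (mulfI q0); rewrite mulr0; set c := _ / _.
have cq : c * q.[r] = s^-1 - w.[r] by rewrite divfK.
transitivity (m.[r] * q.[r] + (c * q.[r]) * (c * q.[r] + w.[r] + w.[r]) * r).
  by ring.
by rewrite -Hr cq rs; field.
Qed.

Lemma sqrt_inverse_modp (R : rcfType) (s : seq R) :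
  all (fun r => 0 < r) s ->
  exists w : {poly R}, \prod_(r <- s) ('X - r%:P) %| w ^+ 2 * 'X - 1.
Proof.
elim: s => [_ | r s IHs /= /andP[r0 /IHs[w Hw]]].
  by exists 0; rewrite big_nil dvd1p.
by rewrite big_cons mulrC; apply: sqrt_inverse_lift Hw.
Qed.

(** Over [R[i]] the polynomial splits and all roots are real, so the product of its linear factors
    comes from [R]; associatedness over [R[i]] descends to [R]. *)
Lemma cpoly_splits (R : realType) (p : {poly R}) :
  p != 0 -> (forall t, root (cpoly p) t -> Im t = 0 /\ 0 < Re t) ->
  exists2 s, all (fun r => 0 < r) s & p %= \prod_(r <- s) ('X - r%:P).
Proof.
move=> p0 posp.
have [rs Hrs] := closed_field_poly_normal (cpoly p).
have lc0 : lead_coef (cpoly p) != 0.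
  by rewrite lead_coef_eq0 map_poly_eq0.
have rsP t : t \in rs -> ((complex.Re t)%:C)%C = t /\ 0 < complex.Re t.
  move=> trs; have /posp[] : root (cpoly p) t.
    by rewrite Hrs rootZ // root_prod_XsubC.
  (* In the hypothesis [Re t] and [Im t] are complex numbers; they are exchanged here for the real
     components of [t]. *)
  case: t {trs} => a b; rewrite -complexIm -complexRe /= ltcR.
  by move=> /(congr1 (@complex.Re _)) /= ->.
exists (map (@complex.Re R) rs).
  by apply/allP => _ /mapP[t /rsP[_ ?] ->].
rewrite -(eqp_map (real_complex R)) -/(cpoly p) Hrs.
rewrite big_map rmorph_prod /=.
rewrite [X in _ %= X](eq_big_seq (fun t => 'X - t%:P)) ?eqp_scale //.
by move=> t /rsP[tE _]; rewrite rmorphB /= map_polyX map_polyC /= tE.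
Qed.

(** Writing [p - p.[0]] as [q * 'X] shows that [q * 'X] is the constant [- p.[0]] modulo [p];
    dividing by it inverts ['X]. *)
Lemma inverseX_modp (F : fieldType) (p : {poly F}) :
  p.[0] != 0 -> exists i : {poly F}, p %| i * 'X - 1.
Proof.
move=> p0; have /factor_theorem[q Hq] : root (p - (p.[0])%:P) 0.
  by apply/rootP; rewrite !hornerE subrr.
exists (- (p.[0])^-1 *: q); rewrite subr0 in Hq.
have -> : - (p.[0])^-1 *: q * 'X - 1 = - (p.[0])^-1 *: p.
  rewrite -scalerAl -Hq scalerBr -!mul_polyC rmorphN /= !mulNr -rmorphM.
  by rewrite mulVf //; ring.
by rewrite dvdpZr ?dvdpp // oppr_eq0 invr_eq0.
Qed.

(** * Substitution into multivariate polynomials *)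

Lemma rmorph_mmap n (R S S' : comNzRingType) (phi : {rmorphism S -> S'})
    (f : {rmorphism R -> S}) (g : 'I_n -> S) (p : {mpoly R[n]}) :
  phi (mmap f g p) = mmap (phi \o f) (phi \o g) p.
Proof.
rewrite /mmap rmorph_sum /=; apply: eq_bigr => m _.
rewrite rmorphM /mmap1 rmorph_prod /=; congr (_ * _).
by apply: eq_bigr => i _; rewrite rmorphXn.
Qed.

Lemma eq_mmap n (R S : nzRingType) (f f' : R -> S) (g g' : 'I_n -> S)
    (p : {mpoly R[n]}) : f =1 f' -> g =1 g' -> mmap f g p = mmap f' g' p.
Proof.
move=> Hf Hg; rewrite /mmap; apply: eq_bigr => m _.
by rewrite Hf (mmap1_eq _ Hg).
Qed.

Lemma hdir_horner0 (R : realType) n (h : {mpoly R[n]}) (a u : 'I_n -> R) :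
  (hdir h a u).[0] = h.@[a].
Proof.
rewrite -/(horner_eval 0 (hdir h a u)) /hdir rmorph_mmap /meval.
by apply: eq_mmap => [c | i] /=; rewrite /horner_eval /idfun !hornerE ?subr0.
Qed.

(** * Congruence modulo a two-sided ideal *)

Definition ideal2 (B : nzRingType) (K : B -> Prop) : Prop :=
  [/\ K 0, forall x y, K x -> K y -> K (x + y)
    & forall a x b, K x -> K (a * x * b)].

Section Congruence.
Variables (B : nzRingType) (K : B -> Prop) (idK : ideal2 K).

Lemma ideal2_0 : K 0. Proof. by case: idK. Qed.

Lemma ideal2D x y : K x -> K y -> K (x + y).
Proof. by case: idK => _ H _; apply: H. Qed.

Lemma ideal2Ml a x : K x -> K (a * x).
Proof. by case: idK => _ _ H Kx; rewrite -[a * x]mulr1; apply: H. Qed.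

Lemma ideal2Mr x b : K x -> K (x * b).
Proof. by case: idK => _ _ H Kx; rewrite -[x]mul1r; apply: H. Qed.

Lemma ideal2N x : K x -> K (- x).
Proof. by rewrite -mulN1r; apply: ideal2Ml. Qed.

Lemma ideal2B x y : K x -> K y -> K (x - y).
Proof. by move=> Kx Ky; apply: ideal2D => //; apply: ideal2N. Qed.

Lemma ideal2_sum (I : Type) (r : seq I) (P : pred I) (F : I -> B) :
  (forall i, P i -> K (F i)) -> K (\sum_(i <- r | P i) F i).
Proof.
by move=> KF; elim/big_rec: _ => [|i x Pi]; [apply: ideal2_0 | apply/ideal2D/KF].
Qed.

Definition eqmod (x y : B) := K (x - y).

Lemma eqmod_refl x : eqmod x x.
Proof. by rewrite /eqmod subrr; apply: ideal2_0. Qed.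

Lemma eqmod_sym x y : eqmod x y -> eqmod y x.
Proof. by rewrite /eqmod -opprB => /ideal2N; rewrite opprK. Qed.

Lemma eqmod_trans y x z : eqmod x y -> eqmod y z -> eqmod x z.
Proof. by move=> xy yz; have := ideal2D xy yz; rewrite addrA subrK. Qed.

Lemma eqmodD x x' y y' : eqmod x x' -> eqmod y y' -> eqmod (x + y) (x' + y').
Proof. by rewrite /eqmod opprD addrACA; apply: ideal2D. Qed.

Lemma eqmodM x x' y y' : eqmod x x' -> eqmod y y' -> eqmod (x * y) (x' * y').
Proof.
move=> Kx Ky; rewrite /eqmod.
have -> : x * y - x' * y' = (x - x') * y + x' * (y - y').
  by rewrite mulrBl mulrBr addrA subrK.
by apply: ideal2D; [apply: ideal2Mr | apply: ideal2Ml].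
Qed.

Lemma eqmod_in x y : eqmod x y -> K y -> K x.
Proof. by move=> xy Ky; have := ideal2D xy Ky; rewrite subrK. Qed.

Lemma eqmod_horner (p : {poly B}) x y : eqmod x y -> eqmod p.[x] p.[y].
Proof.
move=> xy; elim/poly_ind: p => [|p c IHp].
  by rewrite !horner0; apply: eqmod_refl.
rewrite !hornerMXaddC; apply: eqmodD (eqmod_refl c).
exact: eqmodM.
Qed.

Lemma eqmod_inv_uniq a b c : eqmod (a * b) 1 -> eqmod (b * c) 1 -> eqmod a c.
Proof.
move=> ab bc; apply: (eqmod_trans (y := a * b * c)).
  rewrite -mulrA -[X in eqmod X _]mulr1.
  by apply: eqmodM (eqmod_refl a) _; apply: eqmod_sym.
by rewrite -[X in eqmod _ X]mul1r; apply: eqmodM ab (eqmod_refl c).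
Qed.

Lemma eqmod_mid a x y b : eqmod x y -> eqmod (a * x * b) (a * y * b).
Proof.
by move=> xy; apply: eqmodM (eqmod_refl b); apply: eqmodM (eqmod_refl a) xy.
Qed.

Lemma eqmod_cancel a b u w : eqmod (u * w) 1 -> eqmod (a * (u * w) * b) (a * b).
Proof. by move=> uw; rewrite -[X in eqmod _ (X * b)]mulr1; apply: eqmod_mid. Qed.

Section SquareRoot.
Variables (w u e : B).
Hypotheses (wu : eqmod (w * u) 1) (uw : eqmod (u * w) 1) (uu : eqmod (u * u) e).

Lemma eqmod_sqrt_mulr : eqmod (e * (w * w)) 1.
Proof.
apply: eqmod_trans uw; apply: (eqmod_trans (y := u * (u * w) * w)).
  rewrite !mulrA; apply: eqmodM (eqmod_refl _); apply: eqmodM (eqmod_refl _).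
  exact: eqmod_sym.
exact: eqmod_cancel.
Qed.

Lemma eqmod_sqrt_mull : eqmod (w * w * e) 1.
Proof.
apply: eqmod_trans wu; apply: (eqmod_trans (y := w * (w * u) * u)).
  rewrite !mulrA -(mulrA _ u u).
  by apply: eqmodM (eqmod_refl _) _; apply: eqmod_sym.
exact: eqmod_cancel.
Qed.

Lemma eqmod_sqrt_mid : eqmod (w * e * w) 1.
Proof.
apply: eqmod_trans wu; apply: (eqmod_trans (y := w * u * (u * w))).
  rewrite !mulrA -(mulrA w u u).
  by apply: eqmod_mid; apply: eqmod_sym.
by rewrite -[X in eqmod _ X]mulr1; apply: eqmodM (eqmod_refl _) _.
Qed.

(** Here [w * w * x] plays the role of [e^-1 x]; being conjugate to it, the symmetric [w * x * w]
    satisfies the same polynomial relations. *)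
Lemma eqmod_sqrt_conj x : eqmod (u * (w * w * x) * w) (w * x * w).
Proof.
rewrite !mulrA -[X in eqmod _ (X * x * w)]mul1r.
by do 3!apply: eqmodM (eqmod_refl _).
Qed.

Lemma eqmod_sqrt_cancel x : eqmod (u * (w * x * w) * u) x.
Proof.
have -> : u * (w * x * w) * u = u * w * x * (w * u) by rewrite !mulrA.
rewrite -[X in eqmod _ X]mul1r -[X in eqmod _ X]mulr1.
by apply: eqmodM wu; apply: eqmodM uw (eqmod_refl _).
Qed.

End SquareRoot.

End Congruence.

(** * Real polynomials evaluated in a ring with central real scalars *)

Section CentralEvaluation.
Variables (R : realType) (B : nzRingType) (io : {rmorphism R -> B}).
Hypothesis ioC : forall x b, io x * b = b * io x.

Let commr_io b : commr_rmorph io b.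
Proof. by move=> x; rewrite /GRing.comm ioC. Qed.

Definition evalc (b : B) : {rmorphism {poly R} -> B} :=
  horner_morph (commr_io b).

Lemma evalcE b p : evalc b p = (map_poly io p).[b]. Proof. by []. Qed.

Lemma evalcX b : evalc b 'X = b.
Proof. by rewrite evalcE map_polyX hornerX. Qed.

Lemma evalcC b c : evalc b c%:P = io c.
Proof. by rewrite evalcE map_polyC hornerC. Qed.

(** Powers of [b] and central scalars commute, so reversing products is harmless. Applied to the
    involution, this makes real polynomials in a self-adjoint element self-adjoint. *)
Lemma evalc_antimorph (sg : B -> B) b p :
  {morph sg : x y / x + y} -> (forall x y, sg (x * y) = sg y * sg x) ->
  (forall c, sg (io c) = io c) -> sg (evalc b p) = evalc (sg b) p.
Proof.
move=> sgD sgM sgio; elim/poly_ind: p => [|p c IHp].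
  by rewrite !rmorph0 -(rmorph0 io) sgio.
rewrite rmorphD rmorphM evalcX evalcC sgD sgM sgio IHp mulrC.
by rewrite rmorphD rmorphM evalcX evalcC.
Qed.

Variables (K : B -> Prop) (idK : ideal2 K).

Lemma evalc_conj u s w p : eqmod K (u * w) 1 -> eqmod K (w * u) 1 ->
  eqmod K (evalc (u * s * w) p) (u * evalc s p * w).
Proof.
move=> uw wu; elim/poly_ind: p => [|p c IHp].
  by rewrite !rmorph0 mulr0 mul0r; apply: eqmod_refl.
rewrite !rmorphD !rmorphM !evalcX mulrDr mulrDl; apply: eqmodD => //.
  apply: (eqmod_trans idK (eqmodM idK IHp (eqmod_refl idK _))).
  have -> : u * evalc s p * w * (u * s * w) = u * evalc s p * (w * u) * (s * w).
    by rewrite !mulrA.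
  have -> : u * (evalc s p * s) * w = u * evalc s p * 1 * (s * w).
    by rewrite mulr1 !mulrA.
  by do !apply: eqmodM => //; apply: eqmod_refl.
rewrite !evalcE map_polyC !hornerC -ioC -mulrA -[X in eqmod _ X _]mulr1.
by apply: eqmodM => //; [apply: eqmod_refl | apply: eqmod_sym].
Qed.

Lemma evalc_eqmod x y p : eqmod K x y -> eqmod K (evalc x p) (evalc y p).
Proof. exact: eqmod_horner. Qed.

Lemma dvdp_evalc b p q : p %| q -> K (evalc b p) -> K (evalc b q).
Proof. by move=> /dvdpP[m ->]; rewrite rmorphM; apply: ideal2Ml. Qed.

Lemma dvdp_eqmod b p q q' : p %| q - q' -> K (evalc b p) ->
  eqmod K (evalc b q) (evalc b q').
Proof. by move=> pq Kp; rewrite /eqmod -rmorphB; apply: dvdp_evalc Kp. Qed.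

Section SqrtModp.
Variables (b : B) (p w : {poly R}).
Hypotheses (pw : p %| w ^+ 2 * 'X - 1) (Kp : K (evalc b p)).

(** Modulo [p], [w] is an inverse square root of ['X], so ['X * w] is both the inverse of [w] and a
    square root of ['X]. *)
Lemma evalc_sqrt_mulr : eqmod K (evalc b w * evalc b ('X * w)) 1.
Proof.
rewrite -rmorphM -(rmorph1 (evalc b)); apply: dvdp_eqmod Kp.
by have -> : w * ('X * w) = w ^+ 2 * 'X by ring.
Qed.

Lemma evalc_sqrt_mull : eqmod K (evalc b ('X * w) * evalc b w) 1.
Proof. by rewrite -rmorphM mulrC rmorphM; apply: evalc_sqrt_mulr. Qed.

Lemma evalc_sqrt_sqr : eqmod K (evalc b ('X * w) * evalc b ('X * w)) b.
Proof.
rewrite -rmorphM -[X in eqmod _ _ X](evalcX b); apply: dvdp_eqmod Kp.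
have -> : 'X * w * ('X * w) - 'X = 'X * (w ^+ 2 * 'X - 1) by ring.
exact: dvdp_mull.
Qed.

End SqrtModp.

Lemma evalc_inv_mull b p i : p %| i * 'X - 1 -> K (evalc b p) ->
  eqmod K (evalc b i * b) 1.
Proof.
move=> pi Kp; rewrite -[X in eqmod _ (_ * X) _](evalcX b) -rmorphM.
by rewrite -(rmorph1 (evalc b)); apply: dvdp_eqmod Kp.
Qed.

Lemma evalc_inv_mulr b p i : p %| i * 'X - 1 -> K (evalc b p) ->
  eqmod K (b * evalc b i) 1.
Proof.
move=> pi Kp; rewrite -[X in eqmod _ (X * _) _](evalcX b) -rmorphM mulrC.
by rewrite -(rmorph1 (evalc b)); apply: dvdp_eqmod Kp.
Qed.

(** A Vandermonde argument by elimination: the value at [2 * x] minus [2 ^+ N] times the value at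
    [x] loses the term of degree [N] and multiplies each lower [c i] by the nonzero scalar
    [2 ^+ i - 2 ^+ N]. *)
Lemma coef_in_ideal2 N (c : nat -> B) :
  (forall x : R, K (\sum_(k < N) io (x ^+ k) * c k)) ->
  forall k, (k < N)%N -> K (c k).
Proof.
elim: N c => [|N IHN] c Kc k //.
have {}IHN i : (i < N)%N -> K (c i).
  move=> ltiN; pose t i : R := 2 ^+ i - 2 ^+ N.
  have t0 : t i != 0.
    by rewrite subr_eq0 lt_eqF // ltr_eXn2l // ltr1n.
  suff : K (io (t i)^-1 * (io (t i) * c i)).
    by rewrite mulrA -rmorphM mulVf // rmorph1 mul1r.
  apply: ideal2Ml => //; apply: (IHN (fun i => io (t i) * c i)) ltiN => x.
  have := ideal2B idK (Kc (2 * x)) (ideal2Ml idK (io (2 ^+ N)) (Kc x)).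
  rewrite mulr_sumr -sumrB big_ord_recr /= !mulrA -!rmorphM exprMn subrr addr0.
  congr K; apply: eq_bigr => j _.
  by rewrite !mulrA -!rmorphM -mulrBl -rmorphB exprMn -mulrBl mulrC.
rewrite ltnS leq_eqVlt => /predU1P[->|/IHN//].
(* With the lower coefficients in [K], the value at 1 isolates the top one. *)
have := Kc 1; rewrite big_ord_recr /= expr1n rmorph1 mul1r => KN.
rewrite -[c N](addKr (\sum_(i < N) io (1 ^+ i) * c i)) addrC.
apply: ideal2B => //; apply: ideal2_sum => // i _.
by apply: ideal2Ml => //; apply: IHN.
Qed.

(** The values at central scalars force every coefficient into [K], so a non-central [x] may then be
    substituted. *)
Lemma poly_in_ideal2 (P : {poly B}) :
  (forall y : R, K P.[io y]) -> forall x, K P.[x].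
Proof.
move=> KP x; rewrite horner_coef; apply: ideal2_sum => // i _.
apply: ideal2Mr => //.
apply: (@coef_in_ideal2 (size P) (fun i => P`_i)) (ltn_ord i) => y.
have := KP y; rewrite horner_coef; congr K; apply: eq_bigr => j _.
by rewrite -rmorphXn ioC.
Qed.

End CentralEvaluation.

(** * From the relations in direction [e] to those in direction [e'] *)

Section ChangeOfDirection.
Variables (R : realType) (B : nzRingType) (io : {rmorphism R -> B}).
Hypothesis ioC : forall x b, io x * b = b * io x.
Variables (K : B -> Prop) (idK : ideal2 K).
Variables (n : nat) (h : {mpoly R[n]}) (e e' : 'I_n -> R).

(* [h(a + y e' - t e)] as a polynomial in [t] with coefficients in [R[y]]. *)
Definition hdir2 (a : 'I_n -> R) : {poly {poly R}} :=
  mmap (polyC \o @polyC R)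
    (fun i => ((a i)%:P + e' i *: 'X)%:P - (e i)%:P *: 'X) h.

Lemma hdir2_eval a y :
  map_poly (horner_eval y) (hdir2 a) = hdir h (fun i => a i + y * e' i) e.
Proof.
rewrite /hdir2 rmorph_mmap; apply: eq_mmap => [c | i] /=.
  by rewrite map_polyC /= /horner_eval hornerC.
rewrite rmorphB /= map_polyC -[(e i)%:P *: _]mul_polyC rmorphM /= map_polyC.
rewrite map_polyX /=.
by rewrite /horner_eval !hornerE mul_polyC [e' i * y]mulrC.
Qed.

(** At [t = 0] only [h(a + y e')] is left, while [hdir] uses [a - t e']; hence the sign change of
    the variable. *)
Lemma hdir2_0 a : hdir h a e' = (hdir2 a).[0] \Po (- 'X).
Proof.
rewrite -/(horner_eval 0 (hdir2 a)) /hdir2 rmorph_mmap rmorph_mmap.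
apply: eq_mmap => [c | i] /=; rewrite /horner_eval !hornerE.
  by rewrite comp_polyC.
by rewrite subr0 comp_polyD comp_polyC comp_polyZ comp_polyX scalerN.
Qed.

Lemma evalc_change_direction a A E V :
  eqmod K (E * V) 1 ->
  (forall y, K (evalc ioC (A + io y * E) (hdir h (fun i => a i + y * e' i) e))) ->
  K (evalc ioC (V * A) (hdir h a e')).
Proof.
move=> EV KAE.
pose G := map_poly (map_poly io) (hdir2 a).
pose L : {poly B} := A%:P + E%:P * 'X.
(* Evaluation at the central [io y] is a ring morphism on [{poly B}], and it turns [G.[L]] into the
   element that the hypothesis puts in [K]. *)
have KP x : K (G.[L]).[x].
  apply: (poly_in_ideal2 ioC idK) => {x} y; apply: eqmod_in (KAE y) => //.
  have cy : commr_rmorph (@idfun B) (io y).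
    by move=> b; rewrite /GRing.comm ioC.
  have ev (q : {poly B}) : horner_morph cy q = q.[io y].
    by rewrite /horner_morph map_poly_id.
  have -> : evalc ioC (A + io y * E) (hdir h (fun i => a i + y * e' i) e) =
      horner_morph cy G.[L].
    rewrite -horner_map /G -map_poly_comp /= evalcE -hdir2_eval -map_poly_comp.
    congr (_.[_]); last by rewrite !ev !hornerE ioC.
    apply: eq_map_poly => q /=; rewrite ev.
    by rewrite horner_map /horner_eval.
  by rewrite ev; apply: eqmod_refl.
(* [G - G.[L]] has the right root [L], so [t - L] is a right factor; the next step reads this at
   [t = 0]. *)
have /factor_theorem[Q HQ] : root (G - (G.[L])%:P) L.
  by apply/rootP; rewrite !hornerE subrr.
have G0 : map_poly io (hdir2 a).[0] = G.[L] - Q.[0] * L.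
  have -> : map_poly io (hdir2 a).[0] = G.[0].
    by rewrite -(rmorph0 (map_poly io)) horner_map.
  have := congr1 (horner^~ 0) HQ; rewrite hornerM_comm; last first.
    by rewrite /comm_poly mul0r mulr0.
  rewrite !(hornerD, hornerN, hornerC, hornerX) sub0r mulrN => /eqP.
  by rewrite subr_eq addrC => /eqP ->.
have -> : evalc ioC (V * A) (hdir h a e') = (map_poly io (hdir2 a).[0]).[- (V * A)].
  rewrite hdir2_0 /comp_poly -horner_map /= -map_poly_comp rmorphN evalcX.
  by congr (_.[_]); apply: eq_map_poly => c /=; rewrite evalcE map_polyC hornerC.
rewrite G0 hornerD hornerN; apply: ideal2B => //.
(* Evaluation at [x] is not multiplicative, since [x] need not commute with [c]: the constant lands
   between the coefficient and the power of [x]. *)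
have hMC (q : {poly B}) c x : (q * c%:P).[x] = \sum_(i < size q) q`_i * c * x ^+ i.
  rewrite (@horner_coef_wide _ (size q)).
    by apply: eq_bigr => i _; rewrite coefMC.
  by apply/leq_sizeP => j qj; rewrite coefMC nth_default ?mul0r.
rewrite /L mulrDr mulrA hornerD hornerMX !hMC mulr_suml -big_split /=.
apply: ideal2_sum => // i _; set x := - (V * A).
(* The two contributions of index [i] combine to [Q.[0]_i * (A + E * x) * x ^+ i], whose middle
   factor is [A - E * V * A], an element of [K]. *)
rewrite -!mulrA -exprSr exprS -mulrDr [E * _]mulrA -mulrDl.
apply: ideal2Ml => //; apply: ideal2Mr => //.
rewrite /x mulrN mulrA -[X in K (X - _)]mul1r.
by apply: eqmodM => //; [apply: eqmod_sym | apply: eqmod_refl].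
Qed.

End ChangeOfDirection.

(** * The two-sided ideal generated by a set *)

Definition glue (T : Type) k k' (f : 'I_k -> T) (f' : 'I_k' -> T) j : T :=
  match fintype.split j with inl i => f i | inr i => f' i end.

Lemma glue_lshift (T : Type) k k' (f : 'I_k -> T) (f' : 'I_k' -> T) j :
  glue f f' (lshift k' j) = f j.
Proof. by rewrite /glue (unsplitK (inl j)). Qed.

Lemma glue_rshift (T : Type) k k' (f : 'I_k -> T) (f' : 'I_k' -> T) j :
  glue f f' (rshift k j) = f' j.
Proof. by rewrite /glue (unsplitK (inr j)). Qed.

Section GeneratedIdeal.
Variables (B : nzRingType) (S : B -> Prop).

(** Has the shape of [ideal_gen] over an arbitrary ring, so that [J h u] is an instance of it by
    conversion. *)
Definition gen_ideal2 (p : B) : Prop :=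
  exists (k : nat) (l s r : 'I_k -> B),
    (forall j, S (s j)) /\ p = \sum_(j < k) l j * s j * r j.

Lemma gen_ideal2P : ideal2 gen_ideal2.
Proof.
split.
- exists 0%N, (fun _ => 0), (fun _ => 0), (fun _ => 0).
  by rewrite big_ord0; split=> // -[].
- move=> x y [k [l [s [r [Ss ->]]]]] [k' [l' [s' [r' [Ss' ->]]]]].
  exists (k + k')%N, (glue l l'), (glue s s'), (glue r r'); split.
    by move=> j; rewrite /glue; case: fintype.split.
  rewrite big_split_ord /=; congr (_ + _); apply: eq_bigr => j _.
    by rewrite !glue_lshift.
  by rewrite !glue_rshift.
- move=> a x b [k [l [s [r [Ss ->]]]]].
  exists k, (fun j => a * l j), s, (fun j => r j * b); split=> //.
  by rewrite mulr_sumr mulr_suml; apply: eq_bigr => j _; rewrite !mulrA.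
Qed.

Lemma gen_ideal2_gen x : S x -> gen_ideal2 x.
Proof.
move=> Sx; exists 1%N, (fun _ => 1), (fun _ => x), (fun _ => 1).
by rewrite big_ord1 mul1r mulr1.
Qed.

Lemma gen_ideal2_morph (B' : nzRingType) (phi : {rmorphism B -> B'}) (K : B' -> Prop) :
  ideal2 K -> (forall x, S x -> K (phi x)) ->
  forall x, gen_ideal2 x -> K (phi x).
Proof.
move=> idK SK _ [k [l [s [r [Ss ->]]]]].
rewrite rmorph_sum; apply: ideal2_sum => // j _; rewrite !rmorphM.
by apply: ideal2Mr => //; apply: ideal2Ml => //; apply: SK.
Qed.

End GeneratedIdeal.

(** * The free algebra: substitution endomorphisms and the involution *)

Section FreeAlgebra.
Variables (R : realType) (n : nat).

Local Notation C := (R[i]).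
Local Notation A := (FA R n).
Local Notation word := (monalg.fmonom 'I_n).
Local Notation mono k c := (monalg.mkmalgU (k : word) (c : C) : A).
Local Notation scal := (@monalg.mkmalgU _ C (@monalg.mone _ : word)).

Lemma scalM c (x : A) : scal c * x = c *: x.
Proof. exact: monalg.mul_malgC. Qed.

Lemma monoM (k l : word) (c d : C) :
  mono k c * mono l d = mono (monalg.mmul k l) (c * d).
Proof. exact: monalg.fgmulUU. Qed.

Lemma FA_ind (P : A -> Prop) :
  P 0 -> (forall x y, P x -> P y -> P (x + y)) -> (forall k c, P (mono k c)) ->
  forall x, P x.
Proof.
by move=> P0 PD Pm x; rewrite (monalg.monalgE x); apply: big_ind.
Qed.

Lemma scal_comm c (x : A) : scal c * x = x * scal c.
Proof.
elim/FA_ind: x => [|x y Hx Hy|k d]; first by rewrite mul0r mulr0.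
  by rewrite mulrDl mulrDr Hx Hy.
by rewrite !monoM monalg.mul1m monalg.mulm1 mulrC.
Qed.

Definition rscal : {rmorphism R -> A} := scal \o real_complex R.

Lemma rscalC x (b : A) : rscal x * b = b * rscal x.
Proof. exact: scal_comm. Qed.

Local Notation ev := (evalc rscalC).

Lemma hzE h (a u : 'I_n -> R) : hz h a u = ev (lin a) (hdir h a u).
Proof.
rewrite evalcE /hz horner_poly; apply: eq_bigr => i _.
by rewrite -scalM.
Qed.

Definition word_subst (F : 'I_n -> A) (m : word) : A := \prod_(i <- m) F i.

Lemma word_subst_mmorphism F : monalg.mmorphism (word_subst F).
Proof.
split=> [m1 m2|]; first by rewrite /word_subst monalg.fmM big_cat.
by rewrite /word_subst monalg.fm1 big_nil.
Qed.

HB.instance Definition _ F :=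
  monalg.isMultiplicative.Build word A (word_subst F) (word_subst_mmorphism F).

(** The endomorphism [z_i |-> F i] given by the universal property of the free algebra; centrality
    of the scalars makes it multiplicative. *)
Definition gen_subst (F : 'I_n -> A) : A -> A := monalg.mmap scal (word_subst F).

HB.instance Definition _ F := GRing.Additive.on (gen_subst F).

Lemma gen_subst_monoid_morphism F : multiplicative (gen_subst F).
Proof. by apply: monalg.commr_mmap_is_multiplicative => g m m'; apply: scal_comm. Qed.

HB.instance Definition _ F :=
  GRing.isMultiplicative.Build A A (gen_subst F) (gen_subst_monoid_morphism F).

Lemma gen_subst_mono F k c : gen_subst F (mono k c) = c *: word_subst F k.
Proof. by rewrite /gen_subst monalg.mmapU scalM. Qed.

Lemma mono_cons i s c :
  mono (monalg.FMonom (i :: s)) c = zvar R i * mono (monalg.FMonom s) c.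
Proof.
rewrite /zvar monoM mul1r; congr (monalg.mkmalgU _ _).
by apply: val_inj; rewrite /= monalg.fmM monalg.fmU.
Qed.

Lemma FA_gen_ind (P : A -> Prop) :
  (forall x y, P x -> P y -> P (x + y)) ->
  (forall x y, P x -> P y -> P (x * y)) ->
  (forall c, P (scal c)) -> (forall i, P (zvar R i)) -> forall x, P x.
Proof.
move=> PD PM Ps Pz; apply: FA_ind => //.
  have <- : scal 0 = 0 :> A by apply: monalg.monalgU0.
  exact: Ps.
move=> [s] c; elim: s => [|i s IHs].
  have -> : monalg.FMonom [::] = monalg.mone :> word by rewrite -monalg.fmoneE.
  exact: Ps.
by rewrite mono_cons; apply: PM.
Qed.

Lemma gen_subst_scal F c : gen_subst F (scal c) = scal c :> A.
Proof. by rewrite gen_subst_mono /word_subst monalg.fm1 big_nil -scalM mulr1. Qed.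

Lemma gen_subst_zvar F i : gen_subst F (zvar R i) = F i :> A.
Proof. by rewrite gen_subst_mono /word_subst monalg.fmU big_seq1 scale1r. Qed.

Lemma gen_subst_ev F x p : gen_subst F (ev x p) = ev (gen_subst F x) p :> A.
Proof.
rewrite !evalcE -horner_map -map_poly_comp; congr (_.[_]).
by apply: eq_map_poly => c; apply: gen_subst_scal.
Qed.

Lemma morph_eqmod_id (K : A -> Prop) (phi : {rmorphism A -> A}) :
  ideal2 K -> (forall c, phi (scal c) = scal c) ->
  (forall i, eqmod K (phi (zvar R i)) (zvar R i)) -> forall x, eqmod K (phi x) x.
Proof.
move=> idK phis phiz; apply: FA_gen_ind => [x y | x y | c | i] //.
- by rewrite rmorphD; apply: eqmodD.
- by rewrite rmorphM; apply: eqmodM.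
- by rewrite phis; apply: eqmod_refl.
Qed.

Definition conj_rmorph : {rmorphism C -> C} := (@conjc R).

(** As an instance of [mmap] the involution inherits additivity and its values on monomials; the
    word map reverses products, so [fstarM] is proved separately. *)
Lemma fstarE (x : A) : fstar x = monalg.mmap (scal \o conj_rmorph)
  (fun k : word => mono (monalg.FMonom (rev (monalg.fmonom_val k))) 1) x.
Proof.
apply: eq_bigr => k _.
by rewrite /= monoM monalg.mul1m mulr1.
Qed.

Lemma fstarD (x y : A) : fstar (x + y) = fstar x + fstar y.
Proof. by rewrite !fstarE monalg.mmapD. Qed.

Lemma fstar_mono (k : word) (c : C) :
  fstar (mono k c) = mono (monalg.FMonom (rev (monalg.fmonom_val k))) (conjc c).
Proof. by rewrite fstarE monalg.mmapU /= monoM monalg.mul1m mulr1. Qed.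

Lemma fstar0 : fstar (0 : A) = 0.
Proof. by rewrite fstarE monalg.mmap0. Qed.

Lemma fstarM (x y : A) : fstar (x * y) = fstar y * fstar x.
Proof.
elim/FA_ind: x => [|x x' Hx Hx'|k c].
- by rewrite mul0r fstar0 mulr0.
- apply: etrans (congr1 (@fstar R n) (mulrDl _ _ _)) _.
  apply: etrans (fstarD _ _) _; apply: etrans (congr2 +%R Hx Hx') _.
  exact: etrans (esym (mulrDr _ _ _)) (congr1 ( *%R _) (esym (fstarD _ _))).
elim/FA_ind: y => [|y y' Hy Hy'|l d].
- by rewrite mulr0 fstar0 mul0r.
- apply: etrans (congr1 (@fstar R n) (mulrDr _ _ _)) _.
  apply: etrans (fstarD _ _) _; apply: etrans (congr2 +%R Hy Hy') _.
  exact: etrans (esym (mulrDl _ _ _)) (congr1 ( *%R^~ _) (esym (fstarD _ _))).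
rewrite monoM !fstar_mono monoM -rmorphM mulrC; congr (monalg.mkmalgU _ _).
by apply: val_inj; rewrite /= !monalg.fmM rev_cat.
Qed.

Lemma fstar_scal c : fstar (scal c : A) = scal (conjc c).
Proof.
rewrite fstar_mono; congr (monalg.mkmalgU _ _).
by apply: val_inj; rewrite /= monalg.fm1.
Qed.

Lemma fstar_rscal (c : R) : fstar (rscal c) = rscal c.
Proof. by rewrite fstar_scal /= oppr0. Qed.

Lemma fstar_zvar i : fstar (zvar R i) = zvar R i :> A.
Proof.
rewrite fstar_mono rmorph1; congr (monalg.mkmalgU _ _).
by apply: val_inj; rewrite /= monalg.fmU.
Qed.

Lemma fstar_ev x p : fstar (ev x p) = ev (fstar x) p :> A.
Proof.
apply: evalc_antimorph; [exact: fstarD | exact: fstarM | exact: fstar_rscal].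
Qed.

Lemma linE a : lin a = \sum_(i < n) rscal (a i) * zvar R i :> A.
Proof. by apply: eq_bigr => i _; rewrite -scalM. Qed.

Lemma antimorph_ext (s1 s2 : A -> A) :
  {morph s1 : x y / x + y} -> (forall x y, s1 (x * y) = s1 y * s1 x) ->
  {morph s2 : x y / x + y} -> (forall x y, s2 (x * y) = s2 y * s2 x) ->
  (forall c, s1 (scal c) = s2 (scal c)) ->
  (forall i, s1 (zvar R i) = s2 (zvar R i)) -> s1 =1 s2.
Proof.
move=> D1 M1 D2 M2 Es Ez; apply: FA_gen_ind => // x y Hx Hy.
  by rewrite D1 D2 Hx Hy.
by rewrite M1 M2 Hx Hy.
Qed.

(** Both composites are additive, reverse products and agree on scalars and on the [z_i], the [F i]
    being self-adjoint. *)
Lemma fstar_subst F x : (forall i, fstar (F i) = F i) ->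
  fstar (gen_subst F x) = gen_subst F (fstar x) :> A.
Proof.
move=> FE.
have D y z : gen_subst F (y + z) = gen_subst F y + gen_subst F z by exact: rmorphD.
have M y z : gen_subst F (y * z) = gen_subst F y * gen_subst F z by exact: rmorphM.
apply: (antimorph_ext (s1 := fun x => fstar (gen_subst F x))
  (s2 := fun x => gen_subst F (fstar x))) x.
- by move=> x y; apply: etrans (congr1 (@fstar R n) (D _ _)) (fstarD _ _).
- by move=> x y; apply: etrans (congr1 (@fstar R n) (M _ _)) (fstarM _ _).
- by move=> x y; apply: etrans (congr1 (gen_subst F) (fstarD _ _)) (D _ _).
- by move=> x y; apply: etrans (congr1 (gen_subst F) (fstarM _ _)) (M _ _).
- by move=> c; rewrite gen_subst_scal !fstar_scal gen_subst_scal.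
- by move=> i; rewrite fstar_zvar gen_subst_zvar.
Qed.

End FreeAlgebra.

(** * The maps [z_i |-> W z_i W] on the hyperbolic algebras *)

Lemma sum_sandwich (B : nzRingType) n (c z : 'I_n -> B) (W : B) :
  (forall i x, c i * x = x * c i) ->
  \sum_(i < n) c i * (W * z i * W) = W * (\sum_(i < n) c i * z i) * W.
Proof.
move=> cC; rewrite mulr_sumr mulr_suml; apply: eq_bigr => i _.
by rewrite !mulrA cC.
Qed.

Lemma sum_translate (B : nzRingType) n (c c' c'' z : 'I_n -> B) (y : B) :
  (forall i, c'' i = c i + y * c' i) ->
  \sum_(i < n) c'' i * z i = \sum_(i < n) c i * z i + y * \sum_(i < n) c' i * z i.
Proof.
move=> cE; rewrite mulr_sumr -big_split /=; apply: eq_bigr => i _.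
by rewrite cE mulrDl mulrA.
Qed.

Section HyperbolicAlgebraIso.
Variables (R : realType) (n : nat).

Local Notation A := (FA R n).
Local Notation scal := (@monalg.mkmalgU _ R[i] (@monalg.mone _ : monalg.fmonom 'I_n)).
Local Notation rscal := (rscal R n).
Local Notation rscalC := (@rscalC R n).
Local Notation ev := (evalc rscalC).

Definition compress (W : A) : A -> A := gen_subst (fun i => W * zvar R i * W).

HB.instance Definition _ W := GRing.RMorphism.on (compress W).

Lemma compress_lin W a : compress W (lin a) = W * lin a * W.
Proof.
rewrite linE -(sum_sandwich _ _ (fun i => rscalC (a i))).
apply: etrans; first exact: (@rmorph_sum _ _ (gen_subst _)).
apply: eq_bigr => i _; apply: etrans; first exact: rmorphM.
by congr (_ * _); [apply: gen_subst_scal | apply: gen_subst_zvar].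
Qed.

Lemma compressM W : {morph compress W : x y / x * y}.
Proof. exact: rmorphM. Qed.

Lemma compressB W : {morph compress W : x y / x - y}.
Proof. exact: rmorphB. Qed.

Lemma compress_scal W c : compress W (scal c) = scal c.
Proof. exact: gen_subst_scal. Qed.

Lemma compress_zvar W i : compress W (zvar R i) = W * zvar R i * W.
Proof. exact: gen_subst_zvar. Qed.

Lemma compress_ev W x p : compress W (ev x p) = ev (compress W x) p.
Proof. exact: gen_subst_ev. Qed.

Lemma lin_translate a b y : lin (fun i => a i + y * b i) = lin a + rscal y * lin b :> A.
Proof.
rewrite !linE; apply: sum_translate => i.
by rewrite rmorphD rmorphM.
Qed.

Lemma fstar_lin a : fstar (lin a) = lin a :> A.
Proof.
rewrite linE; apply: etrans.
  apply: (big_morph (@fstar R n) (@fstarD R n)).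
  by rewrite fstarE; apply: monalg.mmap0.
by apply: eq_bigr => i _; rewrite fstarM fstar_zvar fstar_rscal rscalC.
Qed.

Lemma J_ideal2 (h : {mpoly R[n]}) u : ideal2 (J h u).
Proof. exact: gen_ideal2P. Qed.

Lemma J_hz (h : {mpoly R[n]}) u a : J h u (ev (lin a) (hdir h a u)).
Proof. by rewrite -hzE; apply: gen_ideal2_gen; left; exists a. Qed.

Lemma J_lin (h : {mpoly R[n]}) u : eqmod (J h u) (lin u) 1.
Proof.
apply: (eqmod_sym (J_ideal2 h u)); apply: gen_ideal2_gen; by right.
Qed.

(** Every translate [a + y e'] yields a generator of [J h e], which supplies the hypothesis for all
    real [y]. *)
Lemma J_change_direction (h : {mpoly R[n]}) e e' a V :
  eqmod (J h e) (lin e' * V) 1 -> J h e (ev (V * lin a) (hdir h a e')).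
Proof.
move=> EV; apply: (evalc_change_direction (J_ideal2 h e) EV) => y.
by rewrite -lin_translate; apply: J_hz.
Qed.

Lemma compress_J (h : {mpoly R[n]}) e e' W U :
  eqmod (J h e) (W * U) 1 -> eqmod (J h e) (U * W) 1 ->
  eqmod (J h e) (U * U) (lin e') ->
  forall x, J h e' x -> J h e (compress W x).
Proof.
have idK := J_ideal2 h e.
move=> WU UW UU; apply: gen_ideal2_morph => // x [[a ->]|->].
  have := J_change_direction a (eqmod_sqrt_mulr idK UW UU).
  set p := hdir h a e' => Kp.
  rewrite hzE -[X in J _ _ X]/(compress W _) compress_ev compress_lin -/p.
  (* [p] vanishes at [W * W * lin a] modulo the ideal; conjugation by [U] moves this to
     [W * lin a * W]. *)
  apply: (eqmod_in idK (y := U * ev (W * W * lin a) p * W)); last first.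
    by apply: ideal2Mr => //; apply: ideal2Ml.
  apply: (eqmod_trans idK) (evalc_conj rscalC idK _ _ UW WU).
  apply: eqmod_horner => //; apply: eqmod_sym => //.
  exact: eqmod_sqrt_conj.
(* The generator [1 - lin e'] goes to [1 - W * lin e' * W], and [W] is an inverse square root of
   [lin e']. *)
rewrite rmorphB rmorph1 -[X in J _ _ (_ - X)]/(compress W _) compress_lin.
apply: (eqmod_sym idK); exact: eqmod_sqrt_mid UU.
Qed.

(** The composite sends [z_i] to [W * z_i * W] flanked by two copies of [compress W W'], and these
    are inverse to [W] modulo [K]. *)
Lemma compress_cancel (K : A -> Prop) W W' U :
  ideal2 K -> eqmod K (compress W W') U ->
  eqmod K (U * W) 1 -> eqmod K (W * U) 1 ->
  forall x, eqmod K (compress W (compress W' x)) x.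
Proof.
move=> idK fW UW WU.
pose phi : {rmorphism A -> A} := compress W \o compress W'.
have phis c : phi (scal c) = scal c.
  exact: etrans (congr1 (compress W) (compress_scal _ _)) (compress_scal _ _).
have phiz i : phi (zvar R i) = compress W W' * (W * zvar R i * W) * compress W W'.
  apply: etrans (congr1 (compress W) (compress_zvar _ _)) _.
  by rewrite !compressM compress_zvar.
apply: (morph_eqmod_id idK phis) => i; rewrite phiz.
apply: (eqmod_trans idK) (eqmod_sqrt_cancel idK WU UW _).
by apply: eqmodM => //; apply: eqmodM (eqmod_refl idK _).
Qed.

End HyperbolicAlgebraIso.

(** * The isomorphism and its inverse *)

Unset Implicit Arguments.
Set Strict Implicit.
Set Printing Implicit Defensive.

Theorem theorem2p6 (R : realType) (n : nat) (h : {mpoly R[n]})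
    (e e' : 'I_n -> R) :
  (exists d : nat, h \is d.-homog) ->
  hyperbolic h e ->
  hcone_int h e e' ->
  quot_star_iso (J h e') (J h e).
Proof.
move=> _ [he0 _] pos.
set p := hdir h e' e; set p' := hdir h e e'.
have [w pw] : exists w : {poly R}, p %| w ^+ 2 * 'X - 1.
  (* The zero polynomial would have the root -1, which is not positive. *)
  have p0 : p != 0.
    apply/eqP => p0; have [] := pos (-1).
      by rewrite -/p p0 /cpoly rmorph0 root0.
    by move=> _; rewrite -complexRe ltcR /= ltr0N1.
  have [s s0 ps] := cpoly_splits p0 pos.
  by have [w Hw] := sqrt_inverse_modp s0; exists w; rewrite (eqp_dvdl _ ps).
(* The constant term of [p'] is [h.@[e]], nonzero by hyperbolicity; [i] will invert [lin e] modulo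
   [J h e']. *)
have [i pi] : exists i : {poly R}, p' %| i * 'X - 1.
  by apply: inverseX_modp; rewrite hdir_horner0.
have idK := J_ideal2 h e; have idK' := J_ideal2 h e'.
pose ev := evalc (@rscalC R n).
pose E : FA R n := lin e'; pose W := ev E w; pose U := ev E ('X * w).
have KE : J h e (ev E p) by apply: J_hz.
have WU : eqmod (J h e) (W * U) 1 := evalc_sqrt_mulr idK pw KE.
have UW : eqmod (J h e) (U * W) 1 := evalc_sqrt_mull idK pw KE.
have UU : eqmod (J h e) (U * U) E := evalc_sqrt_sqr idK pw KE.
pose E' : FA R n := lin e; pose N := ev E' i.
have KE' : J h e' (ev E' p') by apply: J_hz.
have NE' : eqmod (J h e') (N * E') 1 := evalc_inv_mull idK' pi KE'.
have E'N : eqmod (J h e') (E' * N) 1 := evalc_inv_mulr idK' pi KE'.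
(* The change of direction from [e'] back to [e], at the point [e'], kills [p] at [N * lin e'],
   which is [N] because [lin e'] is 1 modulo [J h e']. *)
have KN : J h e' (ev N p).
  apply: (eqmod_in idK') (J_change_direction e' E'N).
  apply: eqmod_horner => //; rewrite -[X in eqmod _ X _]mulr1.
  apply: eqmodM (eqmod_refl _ _) _ => //.
  by apply: eqmod_sym => //; apply: J_lin.
(* Since [N] is the inverse of [lin e], the roles of [w] and ['X * w] are exchanged: [W'] is a
   square root of [N] and [U'] one of [E']. *)
pose W' := ev N ('X * w); pose U' := ev N w.
have UW' : eqmod (J h e') (U' * W') 1 := evalc_sqrt_mulr idK' pw KN.
have WU' : eqmod (J h e') (W' * U') 1 := evalc_sqrt_mull idK' pw KN.
have WW' : eqmod (J h e') (W' * W') N := evalc_sqrt_sqr idK' pw KN.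
have UU' : eqmod (J h e') (U' * U') E'.
  exact: (eqmod_inv_uniq idK' (eqmod_sqrt_mull idK' UW' WW') NE').
pose f := compress W; pose g := compress W'.
have fJ x : J h e' x -> J h e (f x) by apply: compress_J WU UW UU x.
have gJ x : J h e x -> J h e' (g x) by apply: compress_J WU' UW' UU' x.
(* [f] takes [E'] to [W * W], hence its inverse [N] to [E], and so [W'], a polynomial in [N], to
   [U]. *)
have fNE' : eqmod (J h e) (f N * f E') 1.
  by have := fJ _ NE'; rewrite /f compressB compressM [compress W 1]rmorph1.
have fE' : eqmod (J h e) (f E') (W * W).
  rewrite [f E']compress_lin -[X in eqmod _ _ (X * W)]mulr1.
  exact: (eqmod_mid idK _ _ (J_lin h e)).
have fN : eqmod (J h e) (f N) E.
  apply: (eqmod_inv_uniq idK _ (eqmod_sqrt_mull idK WU UU)).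
  apply: (eqmod_trans idK) fNE'; apply: (eqmodM idK (eqmod_refl idK _)).
  exact: (eqmod_sym idK).
have fW' : eqmod (J h e) (f W') U.
  rewrite [f W']compress_ev; exact: (evalc_eqmod (@rscalC R n) idK ('X * w) fN).
have gE : eqmod (J h e') (g E) N.
  rewrite [g E]compress_lin; apply: (eqmod_trans idK') WW'.
  rewrite -[X in eqmod _ _ (X * W')]mulr1.
  exact: (eqmod_mid idK' _ _ (J_lin h e')).
have gW : eqmod (J h e') (g W) U'.
  rewrite [g W]compress_ev; exact: (evalc_eqmod (@rscalC R n) idK' w gE).
have fg : forall x, eqmod (J h e) (f (g x)) x by apply: compress_cancel fW' UW WU.
have gf : forall x, eqmod (J h e') (g (f x)) x by apply: compress_cancel gW UW' WU'.
(* [W] is a real polynomial in the self-adjoint [E]; hence the images [W * z_i * W] are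
   self-adjoint. *)
have Wstar : fstar W = W by rewrite fstar_ev fstar_lin.
exists f; split; split.
- by move=> x y /fJ; rewrite /f compressB.
- by move=> x y; rewrite /f rmorphD; exact: (eqmod_refl idK).
- move=> c x; rewrite -scalM /f compressM compress_scal scalM.
  exact: (eqmod_refl idK).
- by move=> x y; rewrite /f compressM; exact: (eqmod_refl idK).
- by rewrite /f rmorph1; exact: (eqmod_refl idK).
- move=> x; rewrite /f /compress fstar_subst; first exact: (eqmod_refl idK).
  by move=> j; rewrite !fstarM Wstar fstar_zvar mulrA.
- move=> x y fxy.
  have gfxy : eqmod (J h e') (g (f x)) (g (f y)).
    by have := gJ _ fxy; rewrite /g compressB.
  have xy : eqmod (J h e') x y.
    apply: (eqmod_trans idK' (eqmod_sym idK' (gf x))).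
    exact: (eqmod_trans idK' gfxy (gf y)).
  exact: xy.
- by move=> x; exists (g x); apply: fg.
Qed.
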